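(* Let $D$ be a finite set with $m+1$ elements ($m\ge1$), $n\ge1$, $\epsilon\ge0$, $0\le\delta\le1$, $0\le p\le\frac1{m+1}$. Let $\{X_d\mid d\in D\}$ be the parent mechanism with $\mathbb{P}(X_d=d)=1-pm$ and $\mathbb{P}(X_d=d')=p$ for all $d'\ne d$, and suppose it is $(\epsilon,\delta)$-differentially private, i.e. $\mathbb{P}(X_d\in A)\le e^{\epsilon}\mathbb{P}(X_{d'}\in A)+\delta$ for all $d,d'\in D$ and $A\subseteq D$. Then the error $\mathcal{E}=\max_{\mathbf{d}\in D^n}\mathbb{E}[h(X_{\mathbf{d}},\mathbf{d})]$ of its product sanitisation mechanism $\{X_{\mathbf{d}}\}$ satisfies $$\frac{1-\delta}{1+\frac{e^{\epsilon}}{m}}\le\frac{\mathcal{E}}{n}\le\frac{m}{m+1}.$$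
   Context: The product sanitisation mechanism with parent $\{X_d\}$ is $X_{\mathbf{d}}=(X^1_{\mathbf{d}},\dots,X^n_{\mathbf{d}})$, $\mathbf{d}\in D^n$, with independent coordinates and $X^i_{\mathbf{d}}$ distributed as $X_{d_i}$. $h$ is the Hamming distance on $D^n$ (number of differing coordinates). *)

(* Defs.v *)
From HB Require Import structures.
From mathcomp Require Export all_boot all_order all_algebra.
From mathcomp Require Export all_classical all_reals all_analysis.

Set Implicit Arguments.
Unset Strict Implicit.
Unset Printing Implicit Defensive.

Import Order.TTheory GRing.Theory Num.Theory.
Local Open Scope classical_set_scope.
Local Open Scope ring_scope.
Local Open Scope ereal_scope.

(* A random element of a finite set E, which carries the discrete sigma-algebra:
   every subset of E is an event. *)
Definition finite_rv (disp : measure_display) (T : measurableType disp)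
    (E : finType) (X : T -> E) : Prop :=
  forall A : set E, measurable (X @^-1` A).

(* The responses lie in the space of databases itself. *)
Definition sanitisation_mechanism (disp : measure_display)
    (T : measurableType disp) (E : finType) (X : E -> T -> E) : Prop :=
  forall d : E, finite_rv (X d).

Definition diff_private (R : realType) (disp : measure_display)
    (T : measurableType disp) (P : probability T R) (E : finType)
    (X : E -> T -> E) (eps delta : R) : Prop :=
  forall (d d' : E) (A : set E),
    P (X d @^-1` A) <= (expR eps)%:E * P (X d' @^-1` A) + delta%:E.

(* Mutual independence: the product rule over every subfamily. *)
Definition mutually_independent (R : realType) (disp : measure_display)
    (T : measurableType disp) (P : probability T R) (E I : finType)
    (Z : I -> T -> E) : Prop :=
  forall (J : {set I}) (A : I -> set E),
    P (\bigcap_(i in [set` J]) (Z i @^-1` A i)) =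
    \prod_(i in J) P (Z i @^-1` A i).

Definition hamming (E : eqType) (n : nat) (x y : n.-tuple E) : nat :=
  #|[pred i : 'I_n | tnth x i != tnth y i]|.

(* Y, defined on (T', Q), is a product sanitisation mechanism with parent X,
   defined on (T, P); only the laws of the X d matter, so the two probability
   spaces may differ. *)
Definition product_mechanism (R : realType)
    (disp : measure_display) (T : measurableType disp) (P : probability T R)
    (disp' : measure_display) (T' : measurableType disp')
    (Q : probability T' R) (E : finType) (n : nat)
    (X : E -> T -> E) (Y : n.-tuple E -> T' -> n.-tuple E) : Prop :=
  sanitisation_mechanism Y /\
  forall dd : n.-tuple E,
    mutually_independent Q (fun (i : 'I_n) w => tnth (Y dd w) i) /\
    forall (i : 'I_n) (A : set E),
      Q ((fun w => tnth (Y dd w) i) @^-1` A) = P (X (tnth dd i) @^-1` A).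

(* -oo is the neutral element of maxe, so this is the maximum as soon as
   n.-tuple E is nonempty. *)
Definition mechanism_error (R : realType) (disp : measure_display)
    (T : measurableType disp) (Q : probability T R) (E : finType) (n : nat)
    (Y : n.-tuple E -> T -> n.-tuple E) : \bar R :=
  \big[maxe/-oo]_(dd : n.-tuple E)
    'E_Q[fun w => (hamming (Y dd w) dd)%:R%R].

(* Main.v *)
(** By linearity of expectation, the expected error on [dd] is the sum over [i]
    of the error probability of the parent at [dd_i], so the error of the
    product mechanism divided by [n] is the largest error probability [q] of the
    parent; independence plays no role.  Here [q = p m], hence the upper bound.
    The lower bound holds for every private parent: if [d] attains [q], then
    [1 - q <= P (X_d' = d') <= e^eps P (X_d = d') + delta] for [d' <> d], and
    summing over the [m] values of [d'] yields [m (1 - q) <= e^eps q + m delta]. *)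
Require Import Defs.
From mathcomp Require Import measurable_realfun ring lra.

Set Implicit Arguments.
Unset Strict Implicit.
Unset Printing Implicit Defensive.

Import Order.TTheory GRing.Theory Num.Theory.
Local Open Scope classical_set_scope.
Local Open Scope ring_scope.
Local Open Scope ereal_scope.

Lemma sume_const (R : realDomainType) (I : finType) (A : {pred I})
    (x : \bar R) : \sum_(i in A) x = #|A|%:R%:E * x.
Proof. by rewrite mule_natl sumr_const. Qed.

Section finite_random_elements.
Context (R : realType) (disp : measure_display) (T : measurableType disp).
Variable P : probability T R.

Lemma expectation_sum_indic (I : Type) (s : seq I) (A : I -> set T) :
  (forall i, measurable (A i)) ->
  'E_P[fun w => (\sum_(i <- s) \1_(A i) w)%R] = \sum_(i <- s) P (A i).
Proof.
move=> mA; rewrite unlock.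
under eq_integral do rewrite -sumEFin.
rewrite ge0_integral_sum //.
- by apply: eq_bigr => i _; rewrite integral_indic // setIT.
- by move=> i; apply/measurable_EFinP; exact: measurable_indic.
Qed.

Lemma expectation_hamming (E : eqType) (n : nat) (Y Z : T -> n.-tuple E) :
  (forall i, measurable [set w | tnth (Y w) i != tnth (Z w) i]) ->
  'E_P[fun w => (hamming (Y w) (Z w))%:R%R] =
  \sum_(i < n) P [set w | tnth (Y w) i != tnth (Z w) i].
Proof.
move=> mYZ; rewrite -expectation_sum_indic //; congr expectation; apply/funext.
move=> w; rewrite /hamming -sum1_card natr_sum big_mkcond /=.
apply: eq_bigr => i _; rewrite indicE inE.
by case: ifPn => [neq|/negP eq]; [rewrite mem_set|rewrite memNset].
Qed.

Lemma finite_rv_probability_sum (E : finType) (X : T -> E) (A : {pred E}) :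
  finite_rv X ->
  P (X @^-1` [set` A]) = \sum_(x in A) P (X @^-1` [set x]).
Proof.
move=> mX.
have -> : X @^-1` [set` A] = \bigcup_(x in [set` A]) (X @^-1` [set x]).
  by apply/seteqP; split=> [w Aw|w [x Ax /= ->]] //; exists (X w).
rewrite measure_fin_bigcup //.
- rewrite -(bigfs _ (index_enum_uniq E)) // => x _ /negP[].
  exact: mem_index_enum.
- by move=> x y _ _ [w [/= <- <-]].
Qed.

End finite_random_elements.

Section error_probability.
Context (R : realType) (disp : measure_display) (T : measurableType disp).
Variables (P : probability T R) (E : finType) (X : E -> T -> E).

Definition error_probability (d : E) : \bar R := P (X d @^-1` [set~ d]).

Definition max_error_probability : \bar R :=
  \big[maxe/-oo]_(d : E) error_probability d.

Lemma max_error_probability_attained :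
  (0 < #|E|)%N -> exists d, max_error_probability = error_probability d.
Proof.
move=> /card_gt0P[d0 _].
have [//||d _ maxE] := @eq_bigmax _ _ _ -oo d0 xpredT error_probability.
  by move=> d _; exact: leNye.
by exists d.
Qed.

Hypothesis mX : sanitisation_mechanism X.

Lemma error_probability_fin_num (d : E) : error_probability d \is a fin_num.
Proof. exact/fin_num_measure/mX. Qed.

Lemma probability_correct (d : E) :
  P (X d @^-1` [set d]) = 1 - error_probability d.
Proof. by rewrite -probability_setC ?preimage_setC ?setCK; last exact: mX. Qed.

Lemma error_probability_sum (d : E) :
  error_probability d = \sum_(d' | d' != d) P (X d @^-1` [set d']).
Proof.
rewrite -(finite_rv_probability_sum P (predC1 d) (mX d)).
by congr (P (_ @^-1` _)); apply/seteqP; split=> d' /= /eqP.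
Qed.

Lemma diff_private_max_error_ge (m : nat) (eps delta : R) :
  (0 < m)%N -> #|E| = m.+1 -> diff_private P X eps delta ->
  ((1 - delta) / (1 + expR eps / m%:R))%:E <= max_error_probability.
Proof.
move=> m_gt0 cardE privX.
have [|d max_d] := max_error_probability_attained; first by rewrite cardE.
have card_others : #|predC1 d| = m by rewrite cardC1 cardE.
have privacy_sum : \sum_(d' | d' != d) (1 - error_probability d) <=
    \sum_(d' | d' != d) ((expR eps)%:E * P (X d @^-1` [set d']) + delta%:E).
  apply: lee_sum => d' _; apply: le_trans (privX d' d [set d']).
  by rewrite probability_correct leeB // -max_d; exact: le_bigmax.
have {privacy_sum} : m%:R%:E * (1 - error_probability d) <=
    (expR eps)%:E * error_probability d + m%:R%:E * delta%:E.
  rewrite error_probability_sum ge0_sume_distrr // -error_probability_sum.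
  by rewrite -card_others -!sume_const -big_split.
have m_gt0R : (0 < m%:R :> R)%R by rewrite ltr0n.
have denom_gt0 : (0 < m%:R + expR eps)%R by rewrite addr_gt0 // expR_gt0.
have -> : ((1 - delta) / (1 + expR eps / m%:R) =
           m%:R * (1 - delta) / (m%:R + expR eps))%R.
  by field; rewrite !gt_eqF.
rewrite max_d -(fineK (error_probability_fin_num d)).
rewrite -EFinB -!EFinM -EFinD !lee_fin ler_pdivrMr //.
lra.
Qed.

End error_probability.

Section product_mechanism.
Context (R : realType) (disp : measure_display) (T : measurableType disp).
Context (disp' : measure_display) (T' : measurableType disp').
Variables (P : probability T R) (Q : probability T' R) (E : finType) (n : nat).
Variables (X : E -> T -> E) (Y : n.-tuple E -> T' -> n.-tuple E).
Hypothesis prodY : product_mechanism P Q X Y.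

Lemma product_mechanism_expected_hamming (t : n.-tuple E) :
  'E_Q[fun w => (hamming (Y t w) t)%:R%R] =
  \sum_(i < n) error_probability P X (tnth t i).
Proof.
have [mY lawY] := prodY.
rewrite (expectation_hamming Q (Z := fun=> t)) => [|i].
- apply: eq_bigr => i _; rewrite /error_probability -(lawY t).2.
  by congr (Q _); apply/seteqP; split=> w /= /eqP.
- exact: (mY t [set y | tnth y i != tnth t i]).
Qed.

Lemma product_mechanism_error :
  (0 < #|E|)%N -> mechanism_error Q Y = n%:R%:E * max_error_probability P X.
Proof.
move=> E_gt0.
have <- : \sum_(i < n) max_error_probability P X =
    n%:R%:E * max_error_probability P X by rewrite sume_const card_ord.
apply/eqP; rewrite eq_le; apply/andP; split.
- apply: bigmax_le => [|t _]; first exact: leNye.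
  rewrite product_mechanism_expected_hamming.
  by apply: lee_sum => i _; exact: le_bigmax.
- have [d max_d] := max_error_probability_attained P X E_gt0.
  have <- : \sum_(i < n) error_probability P X (tnth [tuple d | _ < n] i) =
      \sum_(i < n) max_error_probability P X.
    by apply: eq_bigr => i _; rewrite tnth_mktuple max_d.
  by rewrite -product_mechanism_expected_hamming; exact: le_bigmax.
Qed.

End product_mechanism.

Theorem theorem9 (R : realType) (D : finType) (m n : nat)
  (hm : (1 <= m)%N) (hD : #|D| = m.+1) (hn : (1 <= n)%N)
  (eps delta p : R)
  (heps : (0 <= eps)%R) (hdelta : (0 <= delta <= 1)%R)
  (hp : (0 <= p <= 1 / m.+1%:R)%R)
  (disp : measure_display) (T : measurableType disp) (P : probability T R)
  (X : D -> T -> D)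
  (hX : sanitisation_mechanism X)
  (hXeq : forall d : D, P (X d @^-1` [set d]) = (1 - p * m%:R)%:E)
  (hXneq : forall d d' : D, d' <> d -> P (X d @^-1` [set d']) = p%:E)
  (hDP : diff_private P X eps delta)
  (disp' : measure_display) (T' : measurableType disp')
  (Q : probability T' R) (Y : n.-tuple D -> T' -> n.-tuple D)
  (hY : product_mechanism P Q X Y) :
  ((1 - delta) / (1 + expR eps / m%:R))%:E
    <= mechanism_error Q Y / n%:R%:E /\
  mechanism_error Q Y / n%:R%:E <= (m%:R / m.+1%:R)%:E.
Proof.
have D_gt0 : (0 < #|D|)%N by rewrite hD.
have -> : mechanism_error Q Y / n%:R%:E = max_error_probability P X.
  rewrite (product_mechanism_error hY D_gt0) muleAC divee ?mul1e //.
  by rewrite eqe pnatr_eq0 -lt0n.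
split; first exact: diff_private_max_error_ge.
apply: bigmax_le => [|d _]; first exact: leNye.
have -> : error_probability P X d = (p * m%:R)%:E.
  rewrite (error_probability_sum P hX) (eq_bigr (fun=> p%:E)) => [|d' /eqP].
    by rewrite (sume_const (predC1 d)) cardC1 hD -EFinM mulrC.
  exact: hXneq.
by rewrite lee_fin mulrC ler_wpM2l // -div1r; case/andP: hp.
Qed.
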